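(* There exists a second-countable submetrizable topological space of cardinality $\mathfrak q_0$ which is not symmetrizable.
   Context: A symmetric on a set $X$ is a function $d:X\times X\to[0,\infty)$ such that for all $x,y\in X$: (1) $d(x,y)=0$ if and only if $x=y$; (2) $d(x,y)=d(y,x)$. (No triangle inequality is required.) For $x\in X$ and $\varepsilon>0$ put $B_d(x;\varepsilon)=\{y\in X:d(x,y)<\varepsilon\}$. The topology of a topological space $X$ is generated by $d$ if a subset $U\subseteq X$ is open if and only if for every $x\in U$ there exists $\varepsilon>0$ such that $B_d(x;\varepsilon)\subseteq U$. A topological space is symmetrizable if its topology is generated by some symmetric. A topological space $X$ is submetrizable if it admits a continuous metric, i.e. a metric $\rho:X\times X\to[0,\infty)$ that is continuous with respect to the topology of $X$ (the topology of $X$ need not be generated by $\rho$). A topological space $X$ is a $Q$-space if every subset of $X$ is of type $G_\delta$ in $X$ (an intersection of countably many open sets). The cardinal $\mathfrak q_0$ is the smallest cardinality of a second-countable metrizable space which is not a $Q$-space. *)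

(* Defs.v *)
From mathcomp Require Import all_boot all_order all_algebra.
From mathcomp Require Import all_classical all_reals.
From mathcomp Require Import topology normedtype borel_hierarchy.

Set Implicit Arguments.
Unset Strict Implicit.
Unset Printing Implicit Defensive.

Import Order.TTheory GRing.Theory Num.Theory.
Import numFieldNormedType.Exports.

Local Open Scope classical_set_scope.
Local Open Scope ring_scope.
Local Open Scope card_scope.

Definition is_symmetric {R : realType} {X : Type} (d : X -> X -> R) : Prop :=
  [/\ forall x y, 0 <= d x y,
      forall x y, d x y = 0 <-> x = y
    & forall x y, d x y = d y x].

Definition is_metric {R : realType} {X : Type} (d : X -> X -> R) : Prop :=
  is_symmetric d /\ forall x y z, d x z <= d x y + d y z.

Definition dball {R : realType} {X : Type} (d : X -> X -> R) (x : X) (e : R) :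
  set X := [set y | d x y < e].

(* For a symmetric that is not a metric, the balls need not be open, nor even
   be neighborhoods of their centers. *)
Definition generates_topology {R : realType} {X : topologicalType}
    (d : X -> X -> R) : Prop :=
  forall U : set X,
    open U <-> forall x, U x -> exists2 e : R, 0 < e & dball d x e `<=` U.

Definition symmetrizable (R : realType) (X : topologicalType) : Prop :=
  exists2 d : X -> X -> R, is_symmetric d & generates_topology d.

Definition metrizable (R : realType) (X : topologicalType) : Prop :=
  exists2 d : X -> X -> R, is_metric d & generates_topology d.

Definition submetrizable (R : realType) (X : topologicalType) : Prop :=
  exists2 rho : X -> X -> R,
    is_metric rho & continuous (fun p : X * X => rho p.1 p.2).

Definition Q_space (X : topologicalType) : Prop := forall A : set X, Gdelta A.

Definition metrizable_non_Q_space (R : realType) (Y : topologicalType) : Prop :=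
  [/\ @second_countable Y, metrizable R Y & ~ Q_space Y].

(* [|T| = q_0], where the cardinal q_0 is the least cardinality of a
   second-countable metrizable space that is not a Q-space.  Quantifying over
   topologicalType in a fixed universe is harmless: such spaces have at most
   continuum many points. *)
Definition has_cardinality_q0 (R : realType) (T : Type) : Prop :=
  (exists2 Y : topologicalType,
     metrizable_non_Q_space R Y & [set: T] #= [set: Y]) /\
  (forall Z : topologicalType,
     metrizable_non_Q_space R Z -> [set: T] #<= [set: Z]).

(* Main.v *)
From HB Require Import structures.
Require Import Defs.
From mathcomp Require Import all_boot all_order all_algebra.
From mathcomp Require Import lra interval_inference.
From mathcomp Require Import all_classical all_reals.
From mathcomp Require Import topology normedtype borel_hierarchy.

Set Implicit Arguments.
Unset Strict Implicit.
Unset Printing Implicit Defensive.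

Import Order.TTheory GRing.Theory Num.Theory.
Import numFieldNormedType.Exports.

Local Open Scope classical_set_scope.
Local Open Scope ring_scope.
Local Open Scope card_scope.

(** The idea is to break symmetrizability at a single closed set.  Let [Y] be a
second-countable metrizable non-Q-space of least cardinality and let [B] be a
subset of [Y] that is not of type G-delta.  Refine the topology of [Y] by
declaring the complement of [B] open, and call the result [X] ([adjoin]).
Adding one open set keeps a countable base, and a metric of [Y] stays
continuous on the finer space, so [X] is second-countable and submetrizable,
on the same points as [Y].

Suppose that a symmetric generates the topology of [X].  In a
first-countable Hausdorff space the balls of such a symmetric are
neighborhoods of their centers ([dball_nbhs]); therefore every closed set is
the intersection of the interiors of its [1/n]-neighborhoods, hence of type
G-delta ([closed_Gdelta]).  This applies to [B], which is closed in [X].  But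
the refinement changes neighborhoods only at the points outside [B], so [B]
would already be of type G-delta in [Y] ([adjoin_Gdelta]), a contradiction.

That the cardinal q_0 exists and is attained has two ingredients: the real
line is a second-countable metrizable space in which the rationals are not of
type G-delta, and every nonempty family of cardinals has a least element
([embeds_in_all], by Zorn's lemma). *)

(** * Least cardinalities *)

(** A maximal set of points of the product of the [X i], any two of which
differ in every coordinate, must project onto some [X i]: otherwise a value
missed in each coordinate yields a further point.  Such a projection is a
bijection, and its inverse followed by the [j]-th projection embeds [X i] in
[X j]. *)
Lemma embeds_in_all (I : Type) (X : I -> Type) (i0 : I) :
  exists i, forall j, exists f : X i -> X j, injective f.
Proof.
pose P := [set M : set (forall i, X i) |
  forall i x y, M x -> M y -> x i = y i -> x = y].
have [F FP totF|M [PM Mmax]] := @Zorn_bigcup _ P.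
  move=> i x y [A FA Ax] [B FB By].
  have [AB|BA] := totF _ _ FA FB.
  - exact: (FP _ FB) (AB _ Ax) By.
  - exact: (FP _ FA) Ax (BA _ By).
have [i iM] : exists i, forall a : X i, exists2 x, M x & x i = a.
  apply: contrapT => nsurj.
  have missed i : exists a : X i, forall x, M x -> x i <> a.
    apply: contrapT => all_hit; apply: nsurj; exists i => a.
    apply: contrapT => a_missed; apply: all_hit; exists a => x Mx xia.
    by apply: a_missed; exists x.
  pose y i := projT1 (cid (missed i)).
  have yM i x : M x -> x i <> y i by exact: (projT2 (cid (missed i))).
  apply: (Mmax (M `|` [set y])).
    split; first exact: subsetUl.
    move=> /(_ y (or_intror erefl)) My; exact: (yM i0 y My).
  move=> i x z [Mx|->] [Mz|->] //; first exact: PM.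
  - by move/yM.
  - by move/esym/yM.
exists i => j.
pose g a := projT1 (cid2 (iM a)).
have gM a : M (g a) by rewrite /g; case: cid2.
have gi a : g a i = a by rewrite /g; case: cid2.
exists (fun a => g a j) => a b gab.
by rewrite -(gi a) -(gi b) (PM j _ _ (gM a) (gM b) gab).
Qed.

Lemma least_cardinality (I : Type) (T : I -> Type) (A : forall i, set (T i))
  (i0 : I) : exists i, forall j, A i #<= A j.
Proof.
have [i imin] := @embeds_in_all I (fun i => set_type (A i)) i0.
exists i => j; have [f finj] := imin j.
by apply/card_leP/injfunPex; exists f => // a b _ _; exact: finj.
Qed.

(** The collection of all topological spaces is too large to index the family
in [least_cardinality]; subsets of [Y0] represent every space of cardinality
at most that of [Y0], and a two-element family provides the comparability
needed for the others. *)
Lemma least_non_Q_space (R : realType) (Y0 : topologicalType) :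
  metrizable_non_Q_space R Y0 ->
  exists2 Y : topologicalType, metrizable_non_Q_space R Y &
  forall Z : topologicalType, metrizable_non_Q_space R Z ->
    [set: Y] #<= [set: Z].
Proof.
move=> Y0nQ.
pose I := {S : set Y0 | exists2 Z : topologicalType,
  metrizable_non_Q_space R Z & S #= [set: Z]}.
have IY0 : exists2 Z : topologicalType,
    metrizable_non_Q_space R Z & [set: Y0] #= [set: Z].
  by exists Y0.
have [[S [Y YnQ SY]] Smin] :=
  least_cardinality (fun i : I => sval i) (exist _ _ IY0).
exists Y => // Z ZnQ.
have [[] YZ] := least_cardinality
  (fun b : bool => [set: if b then (Y : Type) else (Z : Type)]) true.
  exact: (YZ false).
have YleY0 : [set: Y] #<= [set: Y0].
  by rewrite -(card_le_eql SY); exact: card_leT.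
have /card_subP[S' S'Z _] := card_le_trans (YZ true) YleY0.
rewrite -(card_le_eql SY) -(card_le_eqr S'Z).
by apply: (Smin (exist _ S' _)); exists Z.
Qed.

(** * Spaces generated by a symmetric *)

(** [W k] is the intersection of those among the first [k] sets of an
enumeration of the base that are neighborhoods of [x]. *)
Lemma nbhs_base_sequence (X : topologicalType) (x : X) :
  @second_countable X ->
  exists2 W : nat -> set X, forall k, nbhs x (W k) &
    forall V, nbhs x V -> \forall k \near \oo, W k `<=` V.
Proof.
move=> [B Bcount [Bopen Bbase]].
have [B0|[g]] := pfcard_geP Bcount.
  by have [U [BU _]] := Bbase x _ filterT; move: BU; rewrite B0.
exists (fun k => \bigcap_(n in [set n | (n < k)%N /\ nbhs x (g n)]) g n).
  move=> k; elim: k => [|k IHk].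
    by apply: filterS filterT => y _ n [].
  have gk : \forall y \near x, nbhs x (g k) -> g k y.
    have [|ngk] := pselect (nbhs x (g k)); first by apply: filterS.
    by apply: filterS filterT => y _ /ngk.
  apply: filterS2 IHk gk => y Wy gky n [].
  by rewrite ltnS leq_eqVlt => /orP[/eqP -> //|nk gn]; apply: Wy.
move=> V /Bbase[U [BU Ux] UV].
have [n _ gnU] := 'surj_g BU.
exists n.+1 => // k /= nk y Wy; apply: UV; rewrite -gnU; apply: Wy; split => //.
by rewrite gnU; exact: open_nbhs_nbhs (conj (Bopen _ BU) Ux).
Qed.

Section symmetric.
Context (R : realType) (X : topologicalType) (d : X -> X -> R).
Hypotheses (d_sym : is_symmetric d) (d_gen : generates_topology d).

Lemma dball_center x (e : R) : 0 < e -> dball d x e x.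
Proof. by case: d_sym => _ d0 _ e0; rewrite /dball/= (d0 x x).2. Qed.

Lemma nbhs_sub_dball x (U : set X) : nbhs x U ->
  exists2 e : R, 0 < e & dball d x e `<=` U.
Proof.
rewrite nbhsE => -[V [oV Vx] VU].
have [e e0 eV] := (d_gen V).1 oV x Vx.
by exists e => //; exact: subset_trans VU.
Qed.

(** If the ball at [x] is not a neighborhood, a sequence [u] outside the ball
converges to [x].  Every point off the range of [u] has a ball that misses the
range: the given ball at [x], and elsewhere one that exists because [u] is
eventually away from the point.  Since the topology is generated by [d], the
complement of the range is open, and it contains the limit [x] but no term of
[u]. *)
Lemma dball_nbhs : hausdorff_space X -> @second_countable X ->
  forall x (e : R), 0 < e -> nbhs x (dball d x e).
Proof.
move=> T2 X2 x e e0; apply: contrapT => not_nbhs.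
have [W Wx Wbase] := nbhs_base_sequence x X2.
have pick_out k : exists y, W k y /\ ~ dball d x e y.
  apply: contrapT => no_y; apply: not_nbhs; apply: filterS (Wx k) => y Wy.
  by apply: contrapT => ndy; apply: no_y; exists y.
have [u uP] := choice pick_out.
have opC : open (~` range u).
  apply/d_gen => y uy.
  have [->|yx] := pselect (y = x).
    by exists e => // z xz [k _ uk]; apply: (uP k).2; rewrite uk.
  have := T2; rewrite open_hausdorff => /(_ y x (introN eqP yx)).
  move=> [[V V'] /= [/set_mem Vy /set_mem V'x] [oV oV' /eqP VV']].
  have [n _ Wn] := Wbase _ (open_nbhs_nbhs (conj oV' V'x)).
  have yfin : nbhs y (V `&` ~` (u @` `I_n)).
    apply: filterI; first exact: open_nbhs_nbhs.
    apply: open_nbhs_nbhs; split; last by move=> [k _ uk]; apply: uy; exists k.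
    rewrite openC.
    apply: (accessible_finite_set_closed.1 (hausdorff_accessible T2)).
    exact/finite_image/finite_II.
  have [r r0 rV] := nbhs_sub_dball yfin; exists r => //.
  apply: subset_trans rV _ => z [Vz zfin] [k _ ukz].
  have [kn|nk] := ltnP k n; first by apply: zfin; exists k.
  suff : (V `&` V') z by rewrite VV'.
  by split => //; rewrite -ukz; apply: (Wn k nk); exact: (uP k).1.
have xC : (~` range u) x.
  by move=> [k _ uk]; apply: (uP k).2; rewrite uk; exact: dball_center.
have [n _ Wn] := Wbase _ (open_nbhs_nbhs (conj opC xC)).
by apply: (Wn n (leqnn n) (u n) (uP n).1); exists n.
Qed.

(** A point [y] outside the closed set [F] has a ball of some radius [e] missing
[F]; by symmetry of [d], no ball of radius at most [e] centered in [F]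
reaches [y]. *)
Lemma closed_Gdelta : (forall x (e : R), 0 < e -> nbhs x (dball d x e)) ->
  forall F : set X, closed F -> Gdelta F.
Proof.
move=> nbhs_ball F cF.
exists (fun n => (\bigcup_(x in F) dball d x n.+1%:R^-1)°).
  by move=> n; exact: open_interior.
apply/seteqP; split => [x Fx n _|y yF].
  rewrite /interior; apply: filterS (nbhs_ball x n.+1%:R^-1 _).
    by move=> z xz; exists x.
  by rewrite invr_gt0.
apply: contrapT => nFy.
have [e e0 eF] := (d_gen (~` F)).1 (closed_openC cF) y nFy.
have [n _ /(_ n (leqnn n)) /= ne] := near_infty_natSinv_lt (PosNum e0).
have [x Fx yx] := interior_subset (yF n I).
case: d_sym => _ _ dC.
by apply: (eF x) => //; rewrite /dball/= dC; exact: lt_trans ne.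
Qed.

End symmetric.

(** * Metrics and submetrizable spaces *)

Section metric.
Context (R : realType) (X : topologicalType) (rho : X -> X -> R).

Lemma metric_dball_open : is_metric rho -> generates_topology rho ->
  forall x e, open (dball rho x e).
Proof.
move=> [_ tri] gen x e; apply/gen => y xy; exists (e - rho x y).
  by rewrite subr_gt0.
by move=> z yz; rewrite /dball/= (le_lt_trans (tri x y z))// -ltrBrDl.
Qed.

(** The balls are only required to be open, so that the lemma applies to
topologies finer than the one generated by [rho]. *)
Lemma metric_continuous : is_metric rho -> (forall x e, open (dball rho x e)) ->
  continuous (fun p : X * X => rho p.1 p.2).
Proof.
move=> [rho_sym tri] oball [x y]; apply/cvgrPdist_lt => e e0 /=.
have e20 : 0 < e / 2 by rewrite divr_gt0.
have nb z : nbhs z (dball rho z (e / 2)).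
  by apply: open_nbhs_nbhs; split => //; exact: dball_center.
exists (dball rho x (e / 2), dball rho y (e / 2)); first by split; exact: nb.
case: rho_sym => _ _ rhoC [a b] [/= xa yb].
rewrite /dball/= in xa yb.
have := tri x a y; have := tri a b y; have := tri a x b; have := tri x y b.
rewrite (rhoC b y) (rhoC a x) ltr_norml => h1 h2 h3 h4.
by apply/andP; split; lra.
Qed.

End metric.

Lemma submetrizable_hausdorff (R : realType) (X : topologicalType) :
  submetrizable R X -> hausdorff_space X.
Proof.
move=> [rho [[rho_ge0 rho0 rhoC] tri] crho] p q pq.
apply/rho0/eqP; rewrite eq_le rho_ge0 andbT; apply/ler_addgt0Pl => e e0.
have nb z : nbhs z (dball rho z (e / 2)).
  have : rho z x @[x --> z] --> rho z z.
    apply: (@cvg_comp _ _ _ (fun x => (z, x)) (fun p => rho p.1 p.2)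
      _ (nbhs (z, z))); last exact: (crho (z, z)).
    by apply: cvg_pair; [exact: cvg_cst|exact: cvg_id].
  rewrite (rho0 z z).2// => /cvgrPdist_lt /(_ (e / 2)).
  rewrite divr_gt0// => /(_ isT); apply: filterS => x.
  by rewrite sub0r normrN ger0_norm.
have [z [pz qz]] := pq _ _ (nb p) (nb q).
rewrite /dball/= in pz qz.
have := tri p z q; rewrite (rhoC z q) => h.
by rewrite addr0; lra.
Qed.

(** * Declaring a set open *)

(** A copy of [Y], so that it can carry a second topology: the coarsest one
that refines the topology of [Y] and makes [A] open. *)
Definition adjoin (Y : topologicalType) (A : set Y) : Type := Y.

Section adjoin.
Context (Y : topologicalType) (A : set Y).
Local Notation X := (adjoin A).

HB.instance Definition _ := Choice.copy X Y.

(** The points of [A] get the traces on [A] of their neighborhoods in [Y], and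
the other points keep their neighborhoods; the implication treats both cases
at once. *)
Definition adjoin_nbhs (x : Y) : set_system Y :=
  [set U : set Y | nbhs x [set y | (A x -> A y) -> U y]].

Let adjoin_nbhs_filter (x : Y) : ProperFilter (adjoin_nbhs x).
Proof.
apply: Build_ProperFilter_ex.
  by move=> U /nbhs_singleton Ux; exists x; exact: Ux.
split.
- by rewrite /adjoin_nbhs/=; apply: filterS filterT.
- move=> U V; rewrite /adjoin_nbhs/=; apply: filterS2 => y Uy Vy Axy.
  by split; [exact: Uy|exact: Vy].
- by move=> U V UV; rewrite /adjoin_nbhs/=; apply: filterS => y Uy /Uy/UV.
Qed.

Let adjoin_nbhs_singleton (x : Y) (U : set Y) : adjoin_nbhs x U -> U x.
Proof. by move=> /nbhs_singleton; exact. Qed.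

Let adjoin_nbhs_nbhs (x : Y) (U : set Y) :
  adjoin_nbhs x U -> adjoin_nbhs x (adjoin_nbhs^~ U).
Proof.
move=> /nbhs_interior; rewrite /adjoin_nbhs/=; apply: filterS => y Uy Axy.
by apply: filterS Uy => z Uz Ayz; apply: Uz => /Axy/Ayz.
Qed.

HB.instance Definition _ := hasNbhs.Build X adjoin_nbhs.

HB.instance Definition _ := Nbhs_isNbhsTopological.Build X
  adjoin_nbhs_filter adjoin_nbhs_singleton adjoin_nbhs_nbhs.

Lemma adjoin_nbhsE (x : X) (U : set X) :
  nbhs x U = nbhs (x : Y) [set y | (A x -> A y) -> U y].
Proof. by []. Qed.

Lemma open_adjoin (U : set Y) : open U -> open (U : set X).
Proof.
rewrite !openE => oU x Ux; rewrite /interior adjoin_nbhsE.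
by apply: filterS (oU x Ux) => y Uy _.
Qed.

Lemma adjoin_open : open (A : set X).
Proof.
rewrite openE => x Ax; rewrite /interior adjoin_nbhsE.
by apply: filterS filterT => y _; exact.
Qed.

Lemma adjoin_second_countable : @second_countable Y -> @second_countable X.
Proof.
move=> [B Bcount [Bopen Bbase]].
pose h (Ub : set Y * bool) : set X := if Ub.2 then Ub.1 `&` A else Ub.1.
exists (h @` (B `*` [set: bool])).
  by apply: sub_countable (card_image_le _ _) _; exact: countableX.
split.
  move=> _ [[U [|]] [/= /Bopen oU _] <-]; rewrite /h/=.
    by apply: openI; [exact: open_adjoin|exact: adjoin_open].
  exact: open_adjoin.
move=> x V; rewrite adjoin_nbhsE => /Bbase[U [BU Ux] UV].
have [Ax|nAx] := pselect (A x).
  exists (U `&` A); last by move=> y [/UV Vy Ay]; exact: Vy.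
  by split; [exists (U, true)|].
exists U; last by move=> y /UV; exact.
by split; [exists (U, false)|].
Qed.

Lemma adjoin_submetrizable (R : realType) : metrizable R Y -> submetrizable R X.
Proof.
move=> [rho rho_metric rho_gen]; exists rho => //.
apply: metric_continuous => // x e; apply: open_adjoin.
exact: metric_dball_open.
Qed.

(** An open set of the refinement is a neighborhood in [Y] of each of its points
outside [A], so its interior in [Y] still contains the complement of [A]. *)
Lemma adjoin_Gdelta : Gdelta (~` A : set X) -> Gdelta (~` A : set Y).
Proof.
move=> [F oF CAF]; exists (fun n => (F n : set Y)°).
  by move=> n; exact: open_interior.
apply/seteqP; split => [x nAx n _|x xF]; last first.
  by rewrite CAF => n _; exact: (interior_subset (xF n I)).
have : @nbhs X X x (F n).
  by apply: open_nbhs_nbhs; split; [exact: oF|move: nAx; rewrite CAF; exact].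
by rewrite adjoin_nbhsE; apply: filterS => y; apply.
Qed.

Lemma adjoin_not_symmetrizable (R : realType) :
  @second_countable Y -> metrizable R Y -> ~ Gdelta (~` A) ->
  ~ symmetrizable R X.
Proof.
move=> Y2 Ymet nGA [d d_sym d_gen]; apply/nGA/adjoin_Gdelta.
apply: (closed_Gdelta d_sym d_gen); last exact/open_closedC/adjoin_open.
apply: dball_nbhs => //; last exact: adjoin_second_countable.
exact: submetrizable_hausdorff (adjoin_submetrizable Ymet).
Qed.

End adjoin.

(** * Existence of q_0, and the theorem *)

Lemma real_line_non_Q_space (R : realType) : metrizable_non_Q_space R R.
Proof.
split; last by move/(_ rational); exact: not_rational_Gdelta.
- pose I (pq : rat * rat) : set R := `]ratr pq.1, ratr pq.2[%classic.
  exists (I @` setT).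
    by apply: sub_countable (card_image_le _ _) _; exact: countableP.
  split; first by move=> _ [pq _ <-]; exact: interval_open.
  move=> x U /nbhs_ballP[e /= e0 eU].
  have [p px] : exists p : rat, ratr p \in `]x - e, x[.
    by apply: rat_in_itvoo; lra.
  have [q qx] : exists q : rat, ratr q \in `]x, x + e[.
    by apply: rat_in_itvoo; lra.
  move: px qx; rewrite !in_itv/= => /andP[ep px] /andP[xq qe].
  exists `]ratr p, ratr q[%classic.
    by split; [exists (p, q)|rewrite /= in_itv/= px xq].
  move=> y /=; rewrite in_itv/= => /andP[py yq]; apply: eU.
  by rewrite /ball/= ltr_norml; apply/andP; split; lra.
- exists (fun x y : R => `|x - y|).
    split; last by move=> x y z; exact: ler_distD.
    split => [x y|x y|x y]; first exact: normr_ge0; last exact: distrC.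
    split => [/normr0_eq0/subr0_eq//|->]; by rewrite subrr normr0.
  move=> U; rewrite openE; split => [oU x Ux|oU x Ux].
    by have /nbhs_ballP[e e0 eU] := oU x Ux; exists e.
  by have [e e0 eU] := oU x Ux; apply/nbhs_ballP; exists e.
Qed.

Theorem mainTheorem2 (R : realType) :
  exists X : topologicalType,
    [/\ @second_countable X, submetrizable R X, has_cardinality_q0 R X
      & ~ symmetrizable R X].
Proof.
have [Y YnQ Ymin] := least_non_Q_space (real_line_non_Q_space R).
have [Y2 Ymet nQ] := YnQ.
have /existsNP[B nGB] : ~ forall B : set Y, Gdelta B := nQ.
exists (adjoin (~` B)); split.
- exact: adjoin_second_countable.
- exact: adjoin_submetrizable.
- by split => //; exists Y => //; exact: card_eqxx.
- by apply: adjoin_not_symmetrizable => //; rewrite setCK.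
Qed.
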